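(* Let $D$ be a digraph. Then $\mathrm{dbw}(D)-1\le \mathrm{dtw}(D)\le 9\,\mathrm{dbw}(D)+1$, where $\mathrm{dbw}(D)$ is the directed branchwidth and $\mathrm{dtw}(D)$ the directed treewidth of $D$.
   Context: All digraphs $D=(V(D),E(D))$ are finite, nonempty and simple: no loops and no parallel edges, but both $(u,v)$ and $(v,u)$ may be present (a digon). A directed walk may repeat vertices. A directed cycle has pairwise distinct vertices; a digon is a directed cycle of length $2$. Directed treewidth. An arborescence $T$ is an orientation of an undirected tree with a unique vertex $r$ (the root) from which all vertices are reachable; for $t\in V(T)$, $T_t$ is the subgraph of $T$ induced by the vertices reachable from $t$. A directed tree decomposition of $D$ is a triple $(T,\beta,\gamma)$ where $T$ is an arborescence, $\beta:V(T)\to 2^{V(D)}$ is such that the sets $\beta(t)$ form a partition of $V(D)$ into nonempty sets, and $\gamma:E(T)\to 2^{V(D)}$ is such that for every $(d,t)\in E(T)$ the set $\gamma((d,t))$ meets every directed walk in $D$ that starts and ends in $\beta(T_t):=\bigcup_{t'\in V(T_t)}\beta(t')$ and contains a vertex not in $\beta(T_t)$. Put $\Gamma(t):=\beta(t)\cup\bigcup_{e\text{ incident with }t}\gamma(e)$. The width is $\max_{t\in V(T)}|\Gamma(t)|-1$, and $\mathrm{dtw}(D)$ is the minimum width of a directed tree decomposition of $D$. Directed branchwidth. A directed branch decomposition of $D$ is a pair $(T,\delta)$ where $T$ is an undirected tree of maximum degree at most three and $\delta$ is a bijection from the set of leaves of $T$ to $V(D)$ (if $|V(D)|=1$, $T$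 is a single vertex, regarded as a leaf, and the width is $0$). For an edge $t_1t_2\in E(T)$ let $T_{t_i}$ be the component of $T-t_1t_2$ containing $t_i$, and $\delta(T_{t_i})$ the set of images of the leaves of $T$ lying in $T_{t_i}$. The thickness of $t_1t_2$ is the minimum size of a set $S\subseteq V(D)$ that meets every directed cycle of $D$ having a vertex in $\delta(T_{t_1})$ and a vertex in $V(D)\setminus\delta(T_{t_1})$. The width of $(T,\delta)$ is the maximum thickness of an edge of $T$, and $\mathrm{dbw}(D)$ is the minimum width of a directed branch decomposition of $D$. *)

(* Defs.v *)
From HB Require Import structures.
From mathcomp Require Import all_boot.
From mathcomp Require Import boolp.

Set Implicit Arguments.
Unset Strict Implicit.
Unset Printing Implicit Defensive.

(* The minimum of [w] over a type proved to be inhabited: no default value is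
   involved. *)
Section MinValue.
Variables (X : Type) (w : X -> nat).

Lemma attained_value : inhabited X -> exists n, `[< exists x, w x = n >].
Proof. by case=> x; exists (w x); apply/asboolP; exists x. Qed.

Definition min_value (inhX : inhabited X) : nat := ex_minn (attained_value inhX).

Lemma min_value_attained inhX : exists x, w x = min_value inhX.
Proof. by rewrite /min_value; case: ex_minnP => n /asboolP. Qed.

Lemma min_value_le inhX x : min_value inhX <= w x.
Proof.
rewrite /min_value; case: ex_minnP => n _; apply.
by apply/asboolP; exists x.
Qed.

End MinValue.

Record digraph := Digraph {
  vertex :> finType;
  arc : rel vertex;
  arc_irreflexive : irreflexive arc;
  vertex_gt0 : 0 < #|vertex| }.

Arguments arc {d}.

Section Trees.
Variable T : finType.
Implicit Type e : rel T.

(* [ucycle e p] also holds for the empty sequence and for every [:: x; y] with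
   [e x y]; graph-theoretic cycles are the ones of length at least 3. *)
Definition is_tree e : Prop :=
  [/\ 0 < #|T|, irreflexive e, symmetric e,
      forall x y, connect e x y
    & forall p : seq T, ucycle e p -> size p <= 2].

Definition is_arborescence (a : rel T) : Prop :=
  [/\ forall x y, a x y -> ~~ a y x,
      is_tree [rel x y | a x y || a y x]
    & exists! r, forall t, connect a r t].

(* In a tree, a vertex of degree 0 is the only vertex, and it counts as a
   leaf. *)
Definition is_leaf e : pred T := [pred t | #|e t| <= 1].

Definition delete_edge e (t1 t2 : T) : rel T :=
  [rel x y | e x y && ([set x; y] != [set t1; t2])].

End Trees.

Definition subtree_bag (V T : finType) (a : rel T) (bag : T -> {set V}) (t : T)
    : {set V} :=
  \bigcup_(s | connect a t s) bag s.

Definition guards (D : digraph) (B S : {set D}) : Prop :=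
  forall (x : D) (p : seq D),
    path arc x p -> x \in B -> last x p \in B ->
    (exists2 v, v \in x :: p & v \notin B) ->
    exists2 v, v \in x :: p & v \in S.

(* Only the values of [dt_guard] on arcs of the arborescence are relevant. *)
Record dtree_decomposition (D : digraph) := DTreeDecomposition {
  dt_node : finType;
  dt_arc : rel dt_node;
  dt_arborescence : is_arborescence dt_arc;
  dt_bag : dt_node -> {set D};
  dt_bag_inj : injective dt_bag;
  dt_bag_partition : partition [set dt_bag t | t : dt_node] [set: D];
  dt_guard : dt_node -> dt_node -> {set D};
  dt_guardP : forall d t, dt_arc d t ->
    guards (subtree_bag dt_arc dt_bag t) (dt_guard d t) }.

Section DirectedTreewidth.
Variable D : digraph.
Implicit Type W : dtree_decomposition D.

Definition dt_Gamma W (t : dt_node W) : {set D} :=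
  dt_bag t :|: \bigcup_(s | dt_arc s t) dt_guard s t
           :|: \bigcup_(s | dt_arc t s) dt_guard t s.

Definition dt_width W : nat := \max_(t : dt_node W) #|dt_Gamma t| - 1.

Lemma dtree_decomposition_exists : inhabited (dtree_decomposition D).
Proof.
pose a : rel unit := fun _ _ => false.
have arbA : is_arborescence a.
  split=> //; last by exists tt; split=> [[]|[]] //; apply: connect0.
  split=> //; first by rewrite card_unit.
    by move=> [] []; apply: connect0.
  by move=> [|[] [|[] p]] //= /andP[].
have injB : injective (fun _ : unit => [set: D]) by move=> [] [].
have partB : partition [set [set: D] | _ : unit] [set: D].
  have -> : [set [set: D] | _ : unit] = [set [set: D]].
    apply/setP=> A; rewrite inE; apply/imsetP/eqP => [[_ _ ->]|->] //.
    by exists tt.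
  rewrite /partition /cover big_set1 eqxx /= inE /trivIset /cover !big_set1.
  rewrite eqxx /= eq_sym -card_gt0 cardsT; exact: vertex_gt0.
by constructor; apply: (@DTreeDecomposition D _ a arbA _ injB partB
  (fun _ _ => set0)).
Qed.

Definition dtw : nat := min_value dt_width dtree_decomposition_exists.

End DirectedTreewidth.

Record dbranch_decomposition (D : digraph) := DBranchDecomposition {
  db_node : finType;
  db_edge : rel db_node;
  db_tree : is_tree db_edge;
  db_degree : forall t, #|db_edge t| <= 3;
  db_delta : {t : db_node | is_leaf db_edge t} -> D;
  db_delta_bij : bijective db_delta }.

Section DirectedBranchwidth.
Variable D : digraph.
Implicit Type B : dbranch_decomposition D.

(* Since [arc] is irreflexive, [ucycle arc p] holds for a nonempty [p] exactly
   when [p] lists the vertices of a directed cycle, digons included. *)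
Definition separates (X S : {set D}) : Prop :=
  forall p : seq D, ucycle arc p ->
    (exists2 u, u \in p & u \in X) -> (exists2 v, v \in p & v \notin X) ->
    exists2 w, w \in p & w \in S.

Lemma separator_exists X : inhabited {S : {set D} | `[< separates X S >]}.
Proof.
constructor; exists [set: D]; apply/asboolP => p _ [u up _] _.
by exists u; rewrite ?inE.
Qed.

Definition thickness (X : {set D}) : nat :=
  min_value (fun S : {S : {set D} | `[< separates X S >]} => #|val S|)
            (separator_exists X).

Definition db_side B (t1 t2 : db_node B) : {set D} :=
  [set db_delta l | l : {t : db_node B | is_leaf (@db_edge D B) t}
                  & connect (delete_edge (@db_edge D B) t1 t2) t1 (val l)].

Definition db_width B : nat :=
  \max_(t1 : db_node B) \max_(t2 | db_edge t1 t2) thickness (db_side t1 t2).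

End DirectedBranchwidth.

Section AttachLeaves.
Variables (T : finType) (e : rel T) (l : T).

Definition attach2 (x y : T + bool) : bool :=
  match x, y with
  | inl x, inl y => e x y
  | inl x, inr _ | inr _, inl x => x == l
  | inr _, inr _ => false
  end.

Lemma attach2_tree : is_tree e -> is_tree attach2.
Proof.
case=> T_gt0 eI eS eC eA.
have S : symmetric attach2 by move=> [x|b] [y|c] /=.
have C0 x y : connect attach2 (inl x) (inl y).
  have /connectP[p] := eC x y.
  elim: p x => [|z p IH] x /= => [_ -> //|/andP[xz zp] yE].
  exact: connect_trans (connect1 _) (IH _ zp yE).
have C1 x : connect attach2 x (inl l).
  by case: x => [x|b]; [apply: C0 | apply: connect1 => /=].
split=> //.
- by rewrite card_sum ltn_addr.
- by case=> [x|b] /=.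
- move=> x y; apply: connect_trans (C1 x) _.
  by rewrite (sym_connect_sym S); apply: C1.
move=> p cp.
have [[b bp]|np] := pselect (exists b, inr b \in p).
  have [i q pE] := rot_to bp.
  rewrite -(size_rot i) pE.
  move: cp; rewrite /ucycle -(rot_cycle i) -(rot_uniq i) pE.
  case: q {pE} => [|x [|y q]] //= /andP[/andP[bx]].
  rewrite rcons_path /= => /andP[_ /andP[_ yl]].
  rewrite !inE => /andP[_ /andP[xN _]]; exfalso; move: xN.
  case: x bx => // x /eqP ->.
  have : last y q \in y :: q by apply: mem_last.
  by case: (last y q) yl => // z /eqP -> ; rewrite inE => ->.
have [q pE] : exists q, p = map inl q.
  elim: p np {cp} => [|[x|b] p IH] np; first by exists [::].
    have [|q ->] := IH; last by exists (x :: q).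
    by move=> [b bp]; apply: np; exists b; rewrite inE bp orbT.
  by case: np; exists b; rewrite inE eqxx.
move: cp; rewrite pE size_map => /andP[cq uq]; apply: eA.
rewrite /ucycle -(map_inj_uniq (f := inl : T -> T + bool)) ?uq ?andbT //;
  last by move=> ? ? [].
case: q cq {pE uq} => //= x q; rewrite -map_rcons path_map.
by apply: sub_path.
Qed.

Lemma card_attach2_inl x : #|attach2 (inl x)| = #|e x| + (x == l) * 2.
Proof.
rewrite -!sum1_card big_sumType /=; congr (_ + _).
case: eqP => xl.
  rewrite mul1n -card_bool -sum1_card; apply: eq_bigl => b.
  by rewrite /in_mem /= xl eqxx.
by rewrite big_pred0 // => b; rewrite /in_mem /=; apply/eqP.
Qed.

Lemma card_attach2_inr b : #|attach2 (inr b)| = 1.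
Proof.
rewrite -!sum1_card big_sumType /= [X in _ + X]big_pred0 // addn0.
by rewrite (big_pred1 l) // => x; rewrite /in_mem /=.
Qed.

End AttachLeaves.

Lemma cubic_tree_exists n : exists (T : finType) (e : rel T),
  [/\ is_tree e, forall t, #|e t| <= 3 & #|is_leaf e| = n.+1].
Proof.
elim: n => [|n [T [e [treeE degE cardE]]]].
  exists unit, (fun _ _ => false); split.
  - split=> //; first by rewrite card_unit.
      by move=> [] []; apply: connect0.
    by move=> [|[] [|[] p]] //= /andP[].
  - by move=> t; rewrite eq_card0.
  rewrite -card_unit; apply: eq_card => -[].
  by rewrite !inE eq_card0.
have /card_gt0P[l leaf_l] : 0 < #|is_leaf e| by rewrite cardE.
exists (T + bool)%type, (attach2 e l); split; first exact: attach2_tree.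
  move=> [t|b]; last by rewrite card_attach2_inr.
  rewrite card_attach2_inl; case: eqP => [->|_]; last by rewrite addn0.
  by rewrite mul1n (leq_add (n1 := 1)).
rewrite -sum1_card big_sumType /=.
rewrite [X in _ + X](eq_bigl predT) => [|b]; last first.
  by rewrite !inE card_attach2_inr.
rewrite [X in _ + X]sum1_card card_bool sum1_card.
rewrite (cardD1 l) leaf_l add1n in cardE.
rewrite (@eq_card _ _ [predD1 is_leaf e & l]) => [|x].
  by case: cardE => ->; rewrite addn2.
rewrite !inE /in_mem /= card_attach2_inl.
by case: eqP => _; rewrite ?addn0 //= mul1n addn2.
Qed.

Lemma dbranch_decomposition_exists (D : digraph) :
  inhabited (dbranch_decomposition D).
Proof.
have [T [e [treeE degE cardE]]] := cubic_tree_exists #|D|.-1.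
rewrite prednK ?vertex_gt0 // -card_sig in cardE.
pose f (x : {t : T | is_leaf e t}) : D := enum_val (cast_ord cardE (enum_rank x)).
have bijf : bijective f.
  exists (fun y => enum_val (cast_ord (esym cardE) (enum_rank y))) => x.
    by rewrite /f enum_valK cast_ordK enum_rankK.
  by rewrite /f enum_valK cast_ordKV enum_rankK.
by constructor; apply: (DBranchDecomposition treeE degE bijf).
Qed.

Definition dbw (D : digraph) : nat :=
  min_value (@db_width D) (dbranch_decomposition_exists D).

(* Main.v *)
Require Import Defs.
From mathcomp Require Import all_boot.
From mathcomp Require Import boolp.
From mathcomp Require Import zify.
(* [path.v] also exports an [arc]; this makes [arc] denote that of digraphs. *)
Import Defs.

(* Lower bound: in a directed tree decomposition, every union of some vertices
   of the bag of [t] and of some subtrees at children of [t] is separated from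
   its complement by [Gamma t]: a directed cycle crossing it either meets the
   bag or leaves a child subtree, hence meets a guard.  So each node can be
   expanded into a binary tree, which yields a branch decomposition whose cuts
   all have separators of size at most [dtw + 1].

   Upper bound: let [k] be the directed branchwidth and [#|X| <= 6k + 1].
   Were every set of at most [3k] vertices to leave a strong component with
   more than [3k] vertices of [X] (and at least two vertices), orienting each
   edge of the branch decomposition towards such a component would yield a
   sink [t]; the union of the at most three separators around [t] leaves no
   such component.  So a set [B] guarded by [X] can be split: with [Z] the
   balanced separator and [b] any vertex of [B], the bag is [b] together with
   [Z :&: B], and the child below a strong component [C] of [D - Z] is guarded
   by [Z] and the vertices of [C] lying in [X] or equal to [b], at most
   [6k + 1] in total.  Then [Gamma] is contained in [X], [Z] and [b], of size
   at most [9k + 2]. *)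

Set Implicit Arguments.
Unset Strict Implicit.
Unset Printing Implicit Defensive.

(** * Trees and arborescences *)

Lemma delete_edgeC (T : finType) (e : rel T) x y :
  delete_edge e x y = delete_edge e y x.
Proof. by rewrite /delete_edge setUC. Qed.

Lemma delete_edge_sym (T : finType) (e : rel T) x y :
  symmetric e -> symmetric (delete_edge e x y).
Proof. by move=> eS u v; rewrite /delete_edge /= eS (setUC [set u]). Qed.

Lemma path_delete_edge (T : finType) (e : rel T) t s x p :
  path e x p -> t \notin x :: p -> path (delete_edge e t s) x p.
Proof.
elim: p x => //= y p IH x /andP[exy pyp].
rewrite !inE !negb_or => /and3P[tx ty tp].
rewrite /delete_edge /= exy IH ?inE ?negb_or ?ty // andbT /=.
apply/eqP => /setP/(_ t).
by rewrite !inE (negPf tx) (negPf ty) eqxx.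
Qed.

(** * The two sides of an edge in an undirected tree *)

Section TreeSides.
Variables (T : finType) (e : rel T).
Hypothesis treeE : is_tree e.

(** A simple path joining [x] to [y] closes up with the edge to a cycle. Acyclicity bounds its size
    by 2, so the path is the deleted edge itself. *)
Lemma tree_bridge x y : e x y -> ~~ connect (delete_edge e x y) x y.
Proof.
case: treeE => _ eI eS _ eA exy; apply/negP => /connectP[p0 pth0 yE0].
case/shortenP: pth0 yE0 => p pth up _ yE {p0}.
have : ucycle e (x :: p).
  rewrite /ucycle up andbT /= rcons_path -yE eS exy andbT.
  by apply: sub_path pth => u v /andP[].
move/eA; case: p pth yE {up} => [|z [|? ?]] //=.
  by move=> _ yE; rewrite yE eI in exy.
by move=> /andP[/andP[_]] + _ yE; rewrite -yE eqxx.
Qed.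

Lemma tree_side_neq x y z :
  e x y -> connect (delete_edge e x y) x z -> z != y.
Proof.
by move=> exy xz; apply: contraTneq xz => ->; apply: tree_bridge.
Qed.

(** The side of [s] avoids [t], so a path inside it cannot use the edge between [t] and [u]; the
    edge from [t] to [s] leads into it. *)
Lemma tree_side_sub s t u z : e s t -> e t u -> s != u ->
  connect (delete_edge e s t) s z -> connect (delete_edge e t u) t z.
Proof.
case: (treeE) => _ eI eS _ _ est etu su sz.
have ts : delete_edge e t u t s.
  rewrite /delete_edge /= eS est; apply/eqP => /setP/(_ s).
  rewrite !inE eqxx orbT (negPf su) orbF.
  by move=> /esym/eqP stE; rewrite stE eI in est.
apply: connect_trans (connect1 ts) _.
case/connectP: sz => p pth ->; apply/connectP; exists p => //.
have tp : t \notin s :: p.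
  apply: contra (tree_bridge est) => tp.
  case/splitPl: tp pth => p1 p2 <-; rewrite cat_path => /andP[pth _].
  by apply/connectP; exists p1.
by apply: path_delete_edge => //; apply: sub_path pth => a b /andP[].
Qed.

Lemma tree_side_cover t z :
  z != t -> exists2 s, e t s & connect (delete_edge e s t) s z.
Proof.
case: (treeE) => _ _ eS eC _ zt.
have /connectP[p0 pth0 zE0] := eC t z.
case/shortenP: pth0 zE0 => p pth up _ zE {p0}.
case: p pth up zE => [|s p] /=; first by move=> _ _ zE; rewrite zE eqxx in zt.
move=> /andP[ets pth] /andP[tp _] zE; exists s => //.
apply/connectP; exists p => //.
by rewrite delete_edgeC; apply: path_delete_edge.
Qed.

Lemma tree_sideC x y z : e x y ->
  connect (delete_edge e x y) y z = ~~ connect (delete_edge e x y) x z.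
Proof.
case: (treeE) => _ _ eS _ _ exy.
have dS := sym_connect_sym (delete_edge_sym x y eS).
apply/idP/idP => [yz|].
  apply/negP => xz; have := tree_bridge exy.
  by rewrite (connect_trans xz) // dS.
have [->|zx] := eqVneq z x; first by rewrite connect0.
have [s exs sz] := tree_side_cover zx.
have [<-|sy] := eqVneq s y; first by rewrite delete_edgeC.
by rewrite (tree_side_sub _ exy sy sz) // eS.
Qed.

(** Read [pts x y] as: the edge is oriented towards [x]. Take an oriented edge whose head side is
    smallest. An edge oriented away from its head [t] would have a strictly smaller head side. *)
Lemma tree_orientation_sink (pts : rel T) :
  (forall x y, e x y -> pts x y || pts y x) ->
  exists t, forall s, e t s -> pts t s.
Proof.
case: (treeE) => T0 _ eS _ _ ptsP.
have [[[x y] /= /andP[exy pxy]]|noe] :=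
    pselect (exists p : T * T, e p.1 p.2 && pts p.1 p.2); last first.
  (* No edge is oriented, hence there is no edge, and any vertex will do. *)
  case/card_gt0P: T0 => t _; exists t => s ets; case: noe.
  case/orP: (ptsP _ _ ets) => p; first by exists (t, s); rewrite /= ets.
  by exists (s, t); rewrite /= eS ets.
pose Q := [pred p : T * T | e p.1 p.2 && pts p.1 p.2].
have Q0 : Q (x, y) by rewrite /= exy.
pose m (p : T * T) := #|connect (delete_edge e p.1 p.2) p.1|.
case: (arg_minnP m Q0) => [[t u]] /= /andP[etu ptu] tu_min.
exists t => s ets; have [->//|su] := eqVneq s u.
case/orP: (ptsP _ _ ets) => // pst.
have est : e s t by rewrite eS.
have := tu_min (s, t); rewrite /= est => /(_ pst).
rewrite leqNgt => /negP[]; apply: proper_card; apply/properP; split.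
  by apply/subsetP => z; apply: tree_side_sub.
exists t; first exact: connect0.
by apply/negP => /(tree_side_neq est); rewrite eqxx.
Qed.

End TreeSides.

(** * Subtrees of an arborescence *)

Section Arborescence.
Variables (T : finType) (a : rel T).
Hypothesis arb : is_arborescence a.
Let e : rel T := [rel x y | a x y || a y x].

Lemma arborescence_acyclic t c : a t c -> ~~ connect a c t.
Proof.
case: arb => asym [_ eI _ _ eA] _ tc; apply/negP => /connectP[p0 pth0 tE0].
case/shortenP: pth0 tE0 => p pth up _ tE {p0}.
have : ucycle e (c :: p).
  rewrite /ucycle up andbT /= rcons_path -tE /e /= tc andbT.
  by apply: sub_path pth => u v uv; rewrite /= uv.
move/eA; case: p pth tE {up} => [_ /= tE|u [|? ?]] //=.
  by move: (eI c); rewrite /= -{1}tE tc.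
by rewrite andbT => cu tE _; subst u; move: (asym _ _ tc); rewrite cu.
Qed.

Lemma arborescence_side t c z :
  a t c -> connect a c z -> connect (delete_edge e c t) c z.
Proof.
move=> tc /connectP[p pth ->]; apply/connectP; exists p => //.
rewrite delete_edgeC; apply: path_delete_edge.
  by apply: sub_path pth => u v uv; rewrite /e /= uv.
apply: contra (arborescence_acyclic tc) => tp.
case/splitPl: tp pth => p1 p2 <-; rewrite cat_path => /andP[pth _].
by apply/connectP; exists p1.
Qed.

(** The subtree at [c'] lies on its side of the edge to [t]. If [c'] differs from [c], that side is
    on the side of [t] for the edge to [c], away from the subtree at [c]. *)
Lemma arborescence_child_inj t c c' z :
  a t c -> a t c' -> connect a c z -> connect a c' z -> c = c'.
Proof.
move=> tc tc' /(arborescence_side tc) cz /(arborescence_side tc') c'z.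
have treeE : is_tree e by case: arb.
have etc : e t c by rewrite /e /= tc.
have ec't : e c' t by rewrite /e /= tc' orbT.
apply/eqP; apply: contraT => cc'.
rewrite eq_sym in cc'; rewrite delete_edgeC in cz.
have tz := tree_side_sub treeE ec't etc cc' c'z.
by rewrite (tree_sideC treeE _ etc) tz in cz.
Qed.

End Arborescence.

Lemma subtree_bag_rec (V T : finType) (a : rel T) (bag : T -> {set V}) t :
  subtree_bag a bag t = bag t :|: \bigcup_(c | a t c) subtree_bag a bag c.
Proof.
apply/setP => v; apply/bigcupP/setUP => [[s /connectP[[|c p] /= pth ->] vs]|].
- by left.
- right; case/andP: pth => tc pth; apply/bigcupP; exists c => //.
  by apply/bigcupP; exists (last c p) => //; apply/connectP; exists p.
case=> [vt|/bigcupP[c tc /bigcupP[s cs vs]]]; first by exists t.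
by exists s => //; apply: connect_trans (connect1 tc) cs.
Qed.

(** Labellings of the trees chosen for different indices have different types, whence the dependent
    form. *)
Lemma dependent_choice (I : Type) (T : I -> Type) (Q : forall i, T i -> Prop) :
  (forall i, exists x, Q i x) -> exists f, forall i, Q i (f i).
Proof. by move=> h; exists (fun i => sval (cid (h i))) => i; apply: svalP. Qed.

(* A finite rooted tree given by its parent function; the rank serves only to
   rule out parent cycles. *)
Record ptree := PTree {
  pt_node :> finType;
  pt_root : pt_node;
  pt_parent : pt_node -> option pt_node;
  pt_rank : pt_node -> nat;
  pt_rank_parent : forall x y, pt_parent x = Some y -> pt_rank y < pt_rank x;
  pt_parent_root : forall x, pt_parent x = None <-> x = pt_root }.

Section ParentTree.
Variable P : ptree.
Implicit Types x y : P.

Definition pt_arc : rel P := [rel x y | pt_parent y == Some x].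
Definition pt_edge : rel P := [rel x y | pt_arc x y || pt_arc y x].

Lemma pt_arc_rank x y : pt_arc x y -> pt_rank x < pt_rank y.
Proof. by move=> /eqP/pt_rank_parent. Qed.

Lemma pt_root_connect x : connect pt_arc (pt_root P) x.
Proof.
have [n] := ubnP (pt_rank x); elim: n x => // n IH x xn.
case E: (pt_parent x) => [y|]; last first.
  by rewrite (pt_parent_root x).1.
have yx := pt_rank_parent E.
apply: connect_trans (IH y _) (connect1 _); last by rewrite /pt_arc /= E.
by lia.
Qed.

Lemma connect_pt_root x : connect pt_arc x (pt_root P) -> x = pt_root P.
Proof.
case/connectP => p; elim/last_ind: p => [|p y _] /=; first by move=> _ ->.
rewrite rcons_path last_rcons => /andP[_ +] yE; rewrite -yE /pt_arc /=.
by rewrite (pt_parent_root _).2.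
Qed.

Lemma pt_arc_connect_parent x y z :
  connect pt_arc x y -> pt_arc z y -> y <> x -> connect pt_arc x z.
Proof.
case/connectP => p; elim/last_ind: p => [|p w _] /=; first by move=> _ ->.
rewrite rcons_path last_rcons => /andP[pth arcw] -> /eqP zw _.
move: arcw; rewrite /pt_arc /= zw => /eqP[->]; apply/connectP.
by exists p.
Qed.

Lemma pt_edge_tree : is_tree pt_edge.
Proof.
have sym : symmetric pt_edge by move=> x y; rewrite /pt_edge /= orbC.
split=> //.
- by apply/card_gt0P; exists (pt_root P).
- move=> x; rewrite /pt_edge /= orbb; apply/negP => /pt_arc_rank.
  by rewrite ltnn.
- have toR x : connect pt_edge (pt_root P) x.
    apply: connect_sub (pt_root_connect x) => u v uv; apply: connect1.
    by rewrite /pt_edge /= uv.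
  move=> x y; apply: connect_trans (toR y).
  by rewrite (sym_connect_sym sym).
move=> p /andP[cp up].
case: p cp up => // x0 p0; set p := x0 :: p0 => cp up.
(* Both neighbours on the cycle of a vertex of maximal rank must be its parent, so they coincide and
   the cycle has size at most 2. *)
have [x xp xmax] : exists2 x, x \in p &
    forall y, y \in p -> pt_rank y <= pt_rank x.
  have xp0 : x0 \in p by rewrite mem_head.
  case: (arg_maxnP (P := [in p]) (@pt_rank P) xp0) => x xp xmax.
  by exists x.
have [i q pE] := rot_to xp.
rewrite -(size_rot i) pE.
have {}xmax y : y \in x :: q -> pt_rank y <= pt_rank x.
  by rewrite -pE mem_rot; apply: xmax.
move: cp up; rewrite -(rot_cycle i) -(rot_uniq i) pE.
case: q xmax {pE} => [|y q] // xmax /=; rewrite rcons_path.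
move=> /andP[xy /andP[_ zx]] /and3P[_ yq _].
have up1 z : z \in x :: y :: q -> pt_edge x z -> pt_parent x = Some z.
  move=> zq /orP[/pt_arc_rank|/eqP//].
  by rewrite ltnNge xmax.
have : pt_parent x = Some (last y q).
  by apply: up1; [rewrite in_cons mem_last orbT | rewrite sym].
rewrite (up1 y) ?inE ?eqxx ?orbT // => -[yz].
case: q yq {xmax zx up1} yz => //= w q.
by move=> + yE; rewrite yE mem_last.
Qed.

Lemma pt_arborescence : is_arborescence pt_arc.
Proof.
split.
- move=> x y /pt_arc_rank xy; apply/negP => /pt_arc_rank; lia.
- exact: pt_edge_tree.
- exists (pt_root P); split; first exact: pt_root_connect.
  by move=> r /(_ (pt_root P))/connect_pt_root.
Qed.

Lemma pt_side x y z : pt_arc y x ->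
  connect (delete_edge pt_edge x y) x z = connect pt_arc x z.
Proof.
move=> yx; apply/idP/idP; case/connectP => p.
  (* The descendants of [x] can only be left through the edge from [x] to its parent, which is
     deleted. *)
  suff H w : connect pt_arc x w -> path (delete_edge pt_edge x y) w p ->
      connect pt_arc x (last w p).
    by move=> pth ->; apply: H.
  elim: p w => //= u p IH w xw /andP[/andP[wu wuN] pth]; apply: IH pth.
  case/orP: wu => wu; first exact: connect_trans (connect1 wu).
  have [wx|/eqP wx] := eqVneq w x; last exact: pt_arc_connect_parent xw wu wx.
  case/eqP: wuN; subst w; congr [set _; _].
  by move: wu yx; rewrite /pt_arc /= => /eqP -> /eqP[].
(* Ranks increase along a descending path, so it never meets [y] and survives the deletion. *)
suff H w : pt_rank x <= pt_rank w -> path pt_arc w p ->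
    connect (delete_edge pt_edge x y) w (last w p).
  by move=> pth ->; apply: H.
elim: p w => //= u p IH w xw /andP[wu pth].
have wu_rank := pt_arc_rank wu; have yx_rank := pt_arc_rank yx.
apply: connect_trans (connect1 _) (IH u _ pth); last by lia.
rewrite /delete_edge /pt_edge /= wu /=; apply/eqP => /setP/(_ y).
rewrite !inE eqxx orbT => /orP[]/eqP yE; subst y; lia.
Qed.

End ParentTree.

Section Graft.
Variables (I : finType) (F : I -> ptree).

(* The disjoint union of the trees [F i] below a new root [None]. *)
Definition graft_node := option {i & F i}.

(** [omap] turns the missing parent of the root of [F i] into [None], the new root, so these roots
    become its children. *)
Definition graft_parent (u : graft_node) : option graft_node :=
  if u is Some v then
    Some (omap (fun y => Tagged (fun i => F i : finType) y)
               (pt_parent (tagged v)))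
  else None.

Definition graft_rank (u : graft_node) : nat :=
  if u is Some v then (pt_rank (tagged v)).+1 else 0.

Lemma graft_rank_parent u v :
  graft_parent u = Some v -> graft_rank v < graft_rank u.
Proof.
case: u => [[i x]|] //= [<-]; case E: (pt_parent x) => [y|] //=.
by rewrite ltnS; apply: pt_rank_parent E.
Qed.

Lemma graft_parent_root u : graft_parent u = None <-> u = None.
Proof. by case: u. Qed.

Definition graft : ptree := PTree graft_rank_parent graft_parent_root.

Definition graft_in i (x : F i) : graft :=
  Some (Tagged (fun i => F i : finType) x).

Lemma graftP (u : graft) :
  u = pt_root graft \/ exists i (x : F i), u = graft_in x.
Proof. by case: u => [[i x]|]; [right; exists i, x | left]. Qed.

Lemma graft_in_arc i (x : F i) u :
  pt_arc (graft_in x) u <-> exists2 y, u = graft_in y & pt_arc x y.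
Proof.
split; last by case=> y -> /eqP xy; rewrite /pt_arc /= xy.
case: u => [[j y]|] //=; rewrite /pt_arc /=.
case E: (pt_parent y) => [z|] //= /eqP/Some_inj/Some_inj xz.
have ij := congr1 tag xz; rewrite /= in ij; subst i.
have zx := eq_from_Tagged xz; subst z.
by exists y => //; apply/eqP.
Qed.

Lemma graft_in_connect i (x : F i) u :
  connect (@pt_arc graft) (graft_in x) u <->
  exists2 y, u = graft_in y & connect (@pt_arc (F i)) x y.
Proof.
split=> [/connectP[p]|[y -> /connectP[p]]]; elim: p x => [|v p IH] x /=.
- by move=> _ ->; exists x.
- move=> /andP[/graft_in_arc[y -> xy] pth] uE.
  have [z -> yz] := IH y pth uE; exists z => //.
  exact: connect_trans (connect1 xy) yz.
- by move=> _ ->.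
- move=> /andP[xv pth] /(IH v pth); apply: connect_trans; apply: connect1.
  by apply/graft_in_arc; exists v.
Qed.

Lemma graft_root_arc u :
  pt_arc (pt_root graft) u <-> exists i, u = graft_in (pt_root (F i)).
Proof.
split; last by case=> j ->; rewrite /pt_arc /= (pt_parent_root _).2.
case: u => [[i x]|] //; rewrite /pt_arc /=.
case E: (pt_parent x) => [y|] // _; exists i.
by rewrite (pt_parent_root x).1.
Qed.

Variable V : finType.

Definition graft_label (A : {set V}) (lab : forall i, F i -> {set V})
    (u : graft) :=
  if u is Some v then lab (tag v) (tagged v) else A.

Lemma subtree_bag_graft_in A lab i (x : F i) :
  subtree_bag (@pt_arc graft) (graft_label A lab) (graft_in x) =
  subtree_bag (@pt_arc (F i)) (lab i) x.
Proof.
apply/setP => v; apply/bigcupP/bigcupP => -[u].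
  by move=> /graft_in_connect[y -> xy] vy; exists y.
by move=> xu vu; exists (graft_in u) => //; apply/graft_in_connect; exists u.
Qed.

Lemma subtree_bag_graft_root A lab :
  subtree_bag (@pt_arc graft) (graft_label A lab) (pt_root graft) =
  A :|: \bigcup_i subtree_bag (@pt_arc (F i)) (lab i) (pt_root (F i)).
Proof.
apply/setP => v; apply/bigcupP/setUP => [[u _]|].
  have [->|[i [x ->]]] := graftP u => vu; [by left | right].
  apply/bigcupP; exists i => //; apply/bigcupP; exists x => //.
  exact: pt_root_connect.
case=> [vA|/bigcupP[i _ /bigcupP[x _ vx]]].
  by exists (pt_root graft).
by exists (graft_in x) => //; apply: pt_root_connect.
Qed.

End Graft.

Lemma graft_in_inj (I : finType) (F : I -> ptree) i : injective (@graft_in I F i).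
Proof. by move=> x y xy; apply: eq_from_Tagged (Some_inj xy). Qed.

Lemma card_graft_in_arc (I : finType) (F : I -> ptree) i (x : F i) :
  #|pt_arc (graft_in x)| = #|pt_arc x|.
Proof.
rewrite -(card_imset _ (@graft_in_inj I F i)); apply: eq_card => u.
apply/idP/imsetP => [/graft_in_arc[y -> xy]|[y xy ->]]; first by exists y.
by apply/graft_in_arc; exists y.
Qed.

Lemma card_graft_root_arc (I : finType) (F : I -> ptree) :
  #|pt_arc (pt_root (graft F))| = #|I|.
Proof.
have inj : injective (fun i => graft_in (pt_root (F i))).
  by move=> i j ij; apply: (congr1 tag (Some_inj ij)).
rewrite -(card_imset _ inj); apply: eq_card => u.
apply/idP/imsetP => [/graft_root_arc[i ->]|[i _ ->]]; first by exists i.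
by apply/graft_root_arc; exists i.
Qed.

(** * Strong components and balanced separators *)

Section StrongComponents.
Variable D : digraph.
Implicit Types (S Z U : {set D}).

Definition avoiding Z : rel D :=
  [rel x y | [&& arc x y, x \notin Z & y \notin Z]].

(** The strong component of [x] in [D - Z]. Vertices of [Z] are kept as isolated ones, so for [x] in
    [Z] this is the singleton of [x]. *)
Definition scomp Z (x : D) : {set D} :=
  [set y | connect (avoiding Z) x y && connect (avoiding Z) y x].

Lemma mem_scomp Z x : x \in scomp Z x.
Proof. by rewrite inE !connect0. Qed.

Lemma scomp_eq Z x y : y \in scomp Z x -> scomp Z y = scomp Z x.
Proof.
rewrite inE => /andP[xy yx]; apply/setP => z; rewrite !inE.
apply/andP/andP => -[h1 h2]; split.
- exact: connect_trans h1.
- exact: connect_trans yx.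
- exact: connect_trans h1.
- exact: connect_trans xy.
Qed.

Lemma scompS S Z x : S \subset Z -> scomp Z x \subset scomp S x.
Proof.
move=> SZ; have sub : subrel (connect (avoiding Z)) (connect (avoiding S)).
  apply: connect_sub => u v /and3P[uv uZ vZ]; apply: connect1.
  by rewrite /avoiding /= uv !(contra (subsetP SZ _)).
by apply/subsetP => y; rewrite !inE => /andP[/sub-> /sub->].
Qed.

Lemma separatesC U S : separates U S -> separates (~: U) S.
Proof.
move=> sep p cp [u up uU] [v vp vU]; apply: sep => //.
  by exists v => //; rewrite inE negbK in vU.
by exists u => //; rewrite inE in uU.
Qed.

Lemma connect_crossing (T : finType) (r : rel T) (U : {set T}) x y :
  connect r x y -> x \in U -> y \notin U ->
  exists u v, [/\ connect r x u, r u v, connect r v y, u \in U & v \notin U].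
Proof.
case/connectP => p; elim: p x => [|z p IH] x /=.
  by move=> _ -> xU; rewrite xU.
move=> /andP[xz pth] yE xU yU.
have [zU|zU] := boolP (z \in U).
  have [u [v [h1 h2 h3 h4 h5]]] := IH z pth yE zU yU.
  by exists u, v; split=> //; apply: connect_trans (connect1 xz) h1.
by exists x, z; split=> //; apply/connectP; exists p.
Qed.

Lemma path_avoiding Z x p : path (avoiding Z) x p -> x \notin Z ->
  forall w, w \in x :: p -> w \notin Z.
Proof.
elim: p x => [|y p IH] x /=; first by move=> _ xZ w; rewrite inE => /eqP->.
move=> /andP[/and3P[_ _ yZ] pth] xZ w; rewrite inE => /orP[/eqP->//|].
exact: IH.
Qed.

(** An arc leaving [U] inside a strong component closes up, by a simple return path avoiding [S], to
    a directed cycle that crosses [U] and misses [S]. *)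
Lemma separates_scomp U S x y :
  separates U S -> y \in scomp S x -> x \in U -> y \in U.
Proof.
rewrite inE => sep /andP[xy yx] xU; apply: contraT => yU.
have [u [v [xu uv vy uU vU]]] := connect_crossing xy xU yU.
have /connectP[p0 pth0 uE0] : connect (avoiding S) v u.
  by apply: connect_trans vy _; apply: connect_trans yx xu.
case/shortenP: pth0 uE0 => p pth up _ uE {p0}.
case/and3P: uv => auv uS vS.
have cyc : ucycle arc (v :: p).
  rewrite /ucycle up andbT /= rcons_path -uE auv andbT.
  by apply: sub_path pth => a b /and3P[].
case: (sep _ cyc).
- by exists u => //; rewrite uE mem_last.
- by exists v => //; rewrite mem_head.
- by move=> w /(path_avoiding pth vS)/negP.
Qed.

Lemma separates_scomp_sub U S x :
  separates U S -> scomp S x \subset U \/ scomp S x \subset ~: U.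
Proof.
move=> sep; have [xU|xU] := boolP (x \in U); [left|right]; apply/subsetP => y ys.
  exact: separates_scomp ys xU.
by apply: separates_scomp (separatesC sep) ys _; rewrite inE.
Qed.

(** Each vertex of the walk is reached from [x] and reaches the last vertex, which leads back to
    [x], all outside [Z]. *)
Lemma walk_scomp Z x p :
  path arc x p -> (forall w, w \in x :: p -> w \notin Z) ->
  last x p \in scomp Z x -> forall w, w \in x :: p -> w \in scomp Z x.
Proof.
move=> pth avoid lx w wp.
have pthZ : path (avoiding Z) x p.
  elim: p x pth avoid {lx wp} => //= y p IH x /andP[xy pth] av.
  rewrite /avoiding /= xy !av ?inE ?eqxx ?orbT ?IH // => v vp.
  by apply: av; rewrite inE vp orbT.
case/splitPl: p / wp pthZ lx {pth avoid} => p1 p2 wE.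
rewrite cat_path last_cat wE => /andP[P1 P2].
rewrite !inE => /andP[_ lx]; apply/andP; split.
  by apply/connectP; exists p1.
by apply: connect_trans lx; apply/connectP; exists p2.
Qed.

End StrongComponents.

Lemma thickness_leP (D : digraph) (U : {set D}) k :
  (exists2 S, separates U S & #|S| <= k) <-> thickness U <= k.
Proof.
rewrite /thickness; split=> [[S /asboolP sepS]|tk].
  by apply: leq_trans; apply: (min_value_le _ _ (exist _ S sepS)).
have [[S sepS] /= SE] := min_value_attained
  (fun S : {S : {set D} | `[< separates U S >]} => #|val S|) (separator_exists U).
by exists S; [apply/asboolP | rewrite SE].
Qed.

(** * Balanced separators from a branch decomposition *)

Section BranchDecomposition.
Variables (D : digraph) (B : dbranch_decomposition D).

Lemma mem_db_side (t1 t2 : db_node B) l :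
  (db_delta l \in db_side t1 t2) =
  connect (delete_edge (@db_edge D B) t1 t2) t1 (val l).
Proof.
apply/imsetP/idP => [[l' + /(bij_inj (@db_delta_bij D B)) ->]|c].
  by rewrite inE.
by exists l; rewrite ?inE.
Qed.

Lemma db_deltaP v : exists l : {t | is_leaf (@db_edge D B) t}, v = db_delta l.
Proof.
by case: (@db_delta_bij D B) => g _ gK; exists (g v); rewrite gK.
Qed.

Lemma db_sideC (t1 t2 : db_node B) :
  db_edge t1 t2 -> db_side t2 t1 = ~: db_side t1 t2.
Proof.
move=> e12; apply/setP => v; have [l ->] := db_deltaP v.
by rewrite inE !mem_db_side (delete_edgeC _ t2) (tree_sideC (db_tree B)).
Qed.

(** For [k = 0] a singleton component can already exceed the bound [3 * k], whence the second
    alternative. *)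
Lemma balanced_separator k (X : {set D}) :
  db_width B <= k -> #|X| <= 6 * k + 1 ->
  exists2 Z : {set D}, #|Z| <= 3 * k &
    forall x, #|scomp Z x :&: X| <= 3 * k \/ #|scomp Z x| <= 1.
Proof.
move=> wB X_small.
have sepE (t1 t2 : db_node B) : db_edge t1 t2 ->
    exists2 S, separates (db_side t1 t2) S & #|S| <= k.
  move=> e12; apply/thickness_leP; apply: leq_trans wB.
  apply: (bigmax_sup t1) => //; exact: (bigmax_sup t2).
apply: contrapT => noZ.
have big (Z : {set D}) : #|Z| <= 3 * k ->
    exists2 x, 3 * k < #|scomp Z x :&: X| & 1 < #|scomp Z x|.
  move=> Zk; apply: contrapT => nox; apply: noZ; exists Z => // x.
  case: (leqP #|scomp Z x :&: X| (3 * k)); first by left.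
  case: (leqP #|scomp Z x| 1); first by right.
  by move=> h1 h2; case: nox; exists x.
(* Two disjoint components of this kind would contain at least [6 * k + 2] vertices of [X]. *)
have big_eq (Z : {set D}) x y :
    3 * k < #|scomp Z x :&: X| -> 3 * k < #|scomp Z y :&: X| ->
    scomp Z x = scomp Z y.
  move=> bx bY.
  have [[z /setIP[/scomp_eq <- /scomp_eq <- //]]|nox] :=
    pselect (exists z, z \in scomp Z x :&: scomp Z y).
  have : #|(scomp Z x :&: X) :|: (scomp Z y :&: X)| <= #|X|.
    by apply: subset_leq_card; rewrite subUset !subsetIr.
  rewrite cardsU (_ : (_ :&: X) :&: (_ :&: X) = set0) ?cards0; last first.
    apply/setP => z; rewrite [RHS]inE.
    apply/negP => /setIP[/setIP[zx _] /setIP[zy _]].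
    by apply: nox; exists z; rewrite inE zx.
  lia.
pose points (t1 t2 : db_node B) S := separates (db_side t1 t2) S /\ #|S| <= k /\
  exists2 x, 3 * k < #|scomp S x :&: X| & scomp S x \subset db_side t1 t2.
pose pts : rel (db_node B) := fun t1 t2 => `[< exists S, points t1 t2 S >].
have ptsP (x y : db_node B) : db_edge x y -> pts x y || pts y x.
  move=> exy; have [S sepS Sk] := sepE _ _ exy.
  have [|z bz _] := big S; first by lia.
  case: (separates_scomp_sub z sepS) => sub; apply/orP; [left|right];
    apply/asboolP; exists S; split=> //.
  - by split=> //; exists z.
  - by rewrite db_sideC //; apply: separatesC.
  - by split=> //; exists z => //; rewrite db_sideC.
have [t t_sink] := tree_orientation_sink (db_tree B) ptsP.
(* The default [set0] at non-neighbours of [t] never enters [Z]. *)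
have /choice[S SP] s : exists S, db_edge t s -> points t s S.
  have [ets|_] := boolP (db_edge t s); last by exists set0.
  by have /asboolP[S ?] := t_sink _ ets; exists S.
pose Z := \bigcup_(s | db_edge t s) S s.
have Zk : #|Z| <= 3 * k.
  apply: leq_trans (_ : \sum_(s | db_edge t s) k <= _); last first.
    by rewrite sum_nat_const leq_mul2r (db_degree t) orbT.
  apply: (@leq_trans (\sum_(s | db_edge t s) #|S s|)); last first.
    by apply: leq_sum => s /SP[_ []].
  rewrite /Z; elim/big_rec2: _ => [|s m A _ IH]; first by rewrite cards0.
  by rewrite cardsU; lia.
have [x bx] := big Z Zk; rewrite leqNgt; case/negP.
(* Since [S s] is contained in [Z], the big component of [D - Z] lies in that of [D - S s], which by
   [big_eq] is the one on the side of [t]. *)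
have side (s : db_node B) : db_edge t s -> scomp Z x \subset db_side t s.
  move=> ets; have [_ [_ [y bY]]] := SP s ets.
  have sub : scomp Z x \subset scomp (S s) x by apply: scompS; apply: bigcup_sup.
  rewrite -(big_eq (S s) x y) //; first exact: subset_trans.
  by apply: leq_trans bx _; apply: subset_leq_card; apply: setSI.
(* The sides of [t] at all its edges have at most the leaf [t] in common, so the component has at
   most one vertex. *)
have atT v : v \in scomp Z x -> exists2 l, v = db_delta l & val l = t.
  move=> vx; have [l vE] := db_deltaP v; exists l => //.
  apply/eqP; apply: contraT => lt.
  have [s ets ls] := tree_side_cover (db_tree B) lt.
  have := subsetP (side s ets) v vx; rewrite vE mem_db_side.
  rewrite delete_edgeC (tree_sideC (db_tree B)) ?ls //.
  by case: (db_tree B) => _ _ ->.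
rewrite ltnS; apply/card_le1_eqP => u v /atT[l -> lt] /atT[l' -> lt'].
by congr db_delta; apply: val_inj; rewrite lt.
Qed.

End BranchDecomposition.

(** * Directed tree decompositions from balanced separators *)

Section TreewidthBound.
Variable D : digraph.

(** [gd t] is the guard of the arc entering [t]. The root also has one, namely [X], reserved for the
    arc by which the piece is grafted below a parent. *)
Definition decomposable w (B X : {set D}) : Prop :=
  exists (P : ptree) (bag gd : P -> {set D}),
  [/\ subtree_bag (@pt_arc P) bag (pt_root P) = B /\ gd (pt_root P) = X,
      forall t, bag t != set0,
      forall v s t, v \in bag s -> v \in bag t -> s = t,
      forall t, guards (subtree_bag (@pt_arc P) bag t) (gd t)
    & forall t, #|bag t :|: gd t :|: \bigcup_(s | pt_arc t s) gd s| <= w].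

(** No arc enters the root of the whole tree, so forgetting [X] there can only shrink [Gamma]. *)
Lemma decomposable_dtw w X : decomposable w [set: D] X -> dtw D <= w - 1.
Proof.
case=> P [bag [gd [[bagT _] bag_n0 bag_disj gdP gd_w]]].
have bag_inj : injective bag.
  move=> s t st; have /set0Pn[v vs] := bag_n0 s.
  by apply: (bag_disj v) => //; rewrite -st.
have bag_part : partition [set bag t | t : P] [set: D].
  apply/and3P; split.
  - rewrite eqEsubset subsetT /=; apply/subsetP => v _; apply/bigcupP.
    have : v \in [set: D] by [].
    rewrite -bagT => /bigcupP[t _ vt]; exists (bag t) => //.
    exact: imset_f.
  - apply/trivIsetP => _ _ /imsetP[s _ ->] /imsetP[t _ ->].
    apply: contraNT; rewrite -setI_eq0 => /set0Pn[v /setIP[vs vt]].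
    by rewrite (bag_disj _ _ _ vs vt).
  - by apply/imsetP => -[t _ /eqP]; rewrite eq_sym (negPf (bag_n0 t)).
have gP d t : pt_arc d t -> guards (subtree_bag (@pt_arc P) bag t) (gd t).
  by move=> _; apply: gdP.
pose W := DTreeDecomposition (pt_arborescence P) bag_inj bag_part gP.
apply: leq_trans (min_value_le _ _ W) _; rewrite /dt_width leq_sub2r //.
apply/bigmax_leqP => t _; apply: leq_trans (gd_w t); apply: subset_leq_card.
rewrite /dt_Gamma /= setSU // setUS //.
by apply/bigcupsP.
Qed.

Lemma decomposable_graft w (I : finType) (Bi Xi : I -> {set D}) (A X : {set D}) :
  A != set0 -> (forall i, decomposable w (Bi i) (Xi i)) ->
  (forall i, [disjoint A & Bi i]) ->
  (forall i j v, v \in Bi i -> v \in Bi j -> i = j) ->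
  guards (A :|: \bigcup_i Bi i) X -> #|A :|: X :|: \bigcup_i Xi i| <= w ->
  decomposable w (A :|: \bigcup_i Bi i) X.
Proof.
move=> An0 dec disjA disjB gX wX.
have [F FP] := dependent_choice dec.
have [bag bagP] := dependent_choice FP.
have [gd gdP] := dependent_choice bagP.
pose G := graft F.
exists G, (graft_label A bag), (graft_label X gd).
have sub_root i : subtree_bag (@pt_arc (F i)) (bag i) (pt_root (F i)) = Bi i.
  by have [[]] := gdP i.
have gd_root i : gd i (pt_root (F i)) = Xi i by have [[]] := gdP i.
have GT : subtree_bag (@pt_arc G) (graft_label A bag) (pt_root G) =
    A :|: \bigcup_i Bi i.
  rewrite subtree_bag_graft_root; congr (_ :|: _).
  by apply: eq_bigr => i _; rewrite sub_root.
have in_Bi i (x : F i) v : v \in bag i x -> v \in Bi i.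
  move=> vx; rewrite -sub_root; apply/bigcupP; exists x => //.
  exact: pt_root_connect.
split=> //.
- move=> t; have [->//|[i [x ->]]] := graftP t.
  by have [_ n0 _ _ _] := gdP i; apply: n0.
- have AB v i (x : F i) : v \in A -> v \in bag i x -> False.
    by move=> vA /in_Bi; rewrite (disjointFr (disjA i) vA).
  move=> v s t; have [->|[i [x ->]]] := graftP s;
    have [->|[j [y ->]]] := graftP t => //=.
  + by move=> vA vy; case: (AB v j y).
  + by move=> vx vA; case: (AB v i x).
  move=> vx vy; have ij := disjB _ _ _ (in_Bi _ _ _ vx) (in_Bi _ _ _ vy).
  subst j; congr graft_in; have [_ _ disj _ _] := gdP i.
  exact: disj vx vy.
- move=> t; have [->|[i [x ->]]] := graftP t; first by rewrite GT.
  rewrite subtree_bag_graft_in; have [_ _ _ gP _] := gdP i; exact: gP.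
- move=> t; have [->|[i [x ->]]] := graftP t.
    apply: leq_trans wX; apply: subset_leq_card; rewrite setUS //.
    apply/bigcupsP => s /graft_root_arc[i ->] /=.
    by rewrite gd_root; apply: bigcup_sup.
  have [_ _ _ _ /(_ x)] := gdP i; apply: leq_trans; apply: subset_leq_card.
  rewrite setUS //; apply/bigcupsP => s /graft_in_arc[y -> xy] /=.
  exact: (bigcup_sup y).
Qed.

Lemma decomposable_balanced k (B X : {set D}) :
  (forall Y : {set D}, #|Y| <= 6 * k + 1 ->
     exists2 Z : {set D}, #|Z| <= 3 * k &
     forall x, #|scomp Z x :&: Y| <= 3 * k \/ #|scomp Z x| <= 1) ->
  B != set0 -> #|X| <= 6 * k + 1 -> guards B X -> decomposable (9 * k + 2) B X.
Proof.
move=> sepE; have [n] := ubnP #|B|; elim: n B X => // n IH B X Bn Bn0 Xk gB.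
have [Z Zk compZ] := sepE X Xk.
have /set0Pn[b bB] := Bn0.
(* The vertex [b] keeps the bag nonempty and makes every remaining part smaller than [B]. *)
pose A := b |: (Z :&: B).
pose R := B :\: A.
have AB : A \subset B by rewrite subUset sub1set bB subsetIr.
pose parts := [set scomp Z x :&: R | x in R].
(* The union over [val C] is the strong component containing [C], written without choosing a
   representative. *)
pose Xi (C : {C : {set D} | C \in parts}) :=
  Z :|: (X :|: [set b]) :&: \bigcup_(x in val C) scomp Z x.
have partsP (C : {C : {set D} | C \in parts}) :
    exists2 x, x \in R & val C = scomp Z x :&: R /\
      \bigcup_(x in val C) scomp Z x = scomp Z x.
  case: C => _ /= /imsetP[x xR ->]; exists x => //; split=> //.
  apply/eqP; rewrite eqEsubset; apply/andP; split.
    by apply/bigcupsP => y /setIP[/scomp_eq -> _].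
  by apply: bigcup_sup; rewrite inE mem_scomp.
have BE : B = A :|: \bigcup_(C : {C : {set D} | C \in parts}) val C.
  apply/setP => v; apply/idP/setUP => [vB|[/(subsetP AB)//|/bigcupP[C _]]].
    have [vA|vA] := boolP (v \in A); [by left | right].
    have vR : v \in R by rewrite inE vA.
    have CP : scomp Z v :&: R \in parts by apply: imset_f.
    pose C : {C : {set D} | C \in parts} := exist _ (scomp Z v :&: R) CP.
    by apply/bigcupP; exists C; rewrite //= inE mem_scomp.
  by have [x _ [-> _]] := partsP C => /setIP[_ /setDP[]].
rewrite BE; apply: (@decomposable_graft _ _ _ Xi).
- by apply/set0Pn; exists b; rewrite !inE eqxx.
- move=> C; have [x xR [CE UE]] := partsP C.
  apply: IH.
  + apply: leq_trans (_ : #|B| <= n); last by rewrite -ltnS.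
    apply: proper_card; apply/properP; split.
      by rewrite CE subIset // subsetDl orbT.
    by exists b => //; rewrite CE !inE eqxx andbF.
  + by apply/set0Pn; exists x; rewrite CE inE mem_scomp.
  + rewrite /Xi UE; have [+ _] := leq_card_setU Z ((X :|: [set b]) :&: scomp Z x).
    move/leq_trans; apply.
    (* The guard has at most [3 * k] vertices from [Z], then either at most [3 * k] from [X] and one
       for [b], or at most one in a trivial component. *)
    case: (compZ x) => [small|single].
      have [+ _] := leq_card_setU (X :&: scomp Z x) ([set b] :&: scomp Z x).
      rewrite -setIUl (setIC X).
      have := subset_leq_card (subsetIl [set b] (scomp Z x)); rewrite cards1.
      lia.
    have := subset_leq_card (subsetIr (X :|: [set b]) (scomp Z x)); lia.
  (* A walk between vertices of [C] that misses the guard misses [Z], so it stays in the strong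
     component. There it misses [X], so it stays in [B]; missing [Z] and [b] as well, it stays in
     [R], hence in [C]. *)
  + move=> y p pth yC lC [v vp vC]; apply: contrapT => noS.
    have avoid w : w \in y :: p -> w \notin Xi C.
      by move=> wp; apply/negP => wX; apply: noS; exists w.
    have inC : {subset y :: p <= scomp Z x}.
      have yx : scomp Z y = scomp Z x.
        by apply: scomp_eq; move: yC; rewrite CE => /setIP[].
      rewrite -yx; apply: walk_scomp pth _ _.
        by move=> w /avoid; rewrite inE negb_or => /andP[].
      by rewrite yx; move: lC; rewrite CE => /setIP[].
    have inR : {subset y :: p <= R}.
      have CB w : w \in val C -> w \in B by rewrite CE => /setIP[_ /setDP[]].
      have inB w : w \in y :: p -> w \in B.
        move=> wp; apply: contraT => wB.
        case: (gB _ _ pth (CB _ yC) (CB _ lC)); first by exists w.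
        move=> u up uX; have := avoid u up.
        by rewrite /Xi UE !in_setU in_setI in_setU uX (inC u up) orbT.
      move=> w wp; have := avoid w wp.
      rewrite /Xi UE in_setU negb_or in_setI (inC w wp) andbT => /andP[wZ].
      by rewrite !inE !negb_or inB // (negPf wZ) => /andP[_ ->].
    by move: vC; rewrite CE in_setI (inC v vp) (inR v vp).
- move=> C; have [x _ [-> _]] := partsP C.
  apply: disjointWr (subsetIr _ _) _.
  by rewrite disjoints_subset /R setDE setCI setCK subsetUr.
- move=> C C' v vC vC'; apply: val_inj; move: vC vC'.
  have [x _ [-> _]] := partsP C; have [y _ [-> _]] := partsP C'.
  by move=> /setIP[/scomp_eq <- _] /setIP[/scomp_eq <- _].
- by rewrite -BE.
(* All guards of children lie in [X], [Z] and [b]: [(6 * k + 1) + 3 * k + 1]. *)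
- apply: (@leq_trans #|b |: (X :|: Z)|).
    apply: subset_leq_card; apply/subsetP => v; rewrite !inE.
    case/orP => [/orP[/orP[->//|/andP[->]]|->]|]; rewrite ?orbT //.
    case/bigcupP => C _; rewrite !inE.
    by case/orP => [->|/andP[/orP[]->]]; rewrite ?orbT.
  rewrite cardsU1; have [+ _] := leq_card_setU X Z; lia.
Qed.

End TreewidthBound.

Lemma dtw_le_dbw (D : digraph) : dtw D <= 9 * dbw D + 1.
Proof.
have [B BE] := min_value_attained (@db_width D) (dbranch_decomposition_exists D).
rewrite (_ : 9 * _ + 1 = 9 * dbw D + 2 - 1); last by lia.
(* The whole vertex set is guarded by the empty set, as no walk leaves it. *)
apply: (@decomposable_dtw _ _ set0); apply: decomposable_balanced.
- by move=> Y; apply: (@balanced_separator D B); rewrite BE.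
- rewrite -card_gt0 cardsT; exact: vertex_gt0.
- by rewrite cards0.
- by move=> x p _ _ _ [v _]; rewrite inE.
Qed.

(** * Branch decompositions from directed tree decompositions *)

Section BranchwidthBound.
Variable D : digraph.

(** A rooted full binary tree whose leaves carry the vertices of [A]. The cut at the root is bounded
    too, so that pieces can be joined. *)
Definition branchable k (A : {set D}) : Prop :=
  exists (P : ptree) (bag : P -> {set D}),
  [/\ subtree_bag (@pt_arc P) bag (pt_root P) = A,
      forall t, thickness (subtree_bag (@pt_arc P) bag t) <= k,
      forall v s t, v \in bag s -> v \in bag t -> s = t
    & forall t, #|pt_arc t| = 2 /\ bag t = set0 \/
                #|pt_arc t| = 0 /\ exists v, bag t = [set v]].

(** Covers both ways to build such a tree: a single leaf for empty [I], and the join of two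
    trees. *)
Lemma branchable_graft k (I : finType) (A : {set D}) (Bi : I -> {set D}) :
  (forall i, branchable k (Bi i)) -> (forall i, [disjoint A & Bi i]) ->
  (forall i j v, v \in Bi i -> v \in Bi j -> i = j) ->
  thickness (A :|: \bigcup_i Bi i) <= k ->
  #|I| = 2 /\ A = set0 \/ #|I| = 0 /\ (exists v, A = [set v]) ->
  branchable k (A :|: \bigcup_i Bi i).
Proof.
move=> brB disjA disjB thk IA.
have [F FP] := dependent_choice brB.
have [bag bagP] := dependent_choice FP.
pose G := graft F.
exists G, (graft_label A bag).
have sub_root i : subtree_bag (@pt_arc (F i)) (bag i) (pt_root (F i)) = Bi i.
  by have [] := bagP i.
have GT : subtree_bag (@pt_arc G) (graft_label A bag) (pt_root G) =
    A :|: \bigcup_i Bi i.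
  rewrite subtree_bag_graft_root; congr (_ :|: _).
  by apply: eq_bigr => i _; rewrite sub_root.
have in_Bi i (x : F i) v : v \in bag i x -> v \in Bi i.
  move=> vx; rewrite -sub_root; apply/bigcupP; exists x => //.
  exact: pt_root_connect.
split=> //.
- move=> t; have [->|[i [x ->]]] := graftP t; first by rewrite GT.
  rewrite subtree_bag_graft_in; have [_ thx _ _] := bagP i; exact: thx.
- have AB v i (x : F i) : v \in A -> v \in bag i x -> False.
    by move=> vA /in_Bi; rewrite (disjointFr (disjA i) vA).
  move=> v s t; have [->|[i [x ->]]] := graftP s;
    have [->|[j [y ->]]] := graftP t => //=.
  + by move=> vA vy; case: (AB v j y).
  + by move=> vx vA; case: (AB v i x).
  move=> vx vy; have ij := disjB _ _ _ (in_Bi _ _ _ vx) (in_Bi _ _ _ vy).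
  subst j; congr graft_in; have [_ _ disj _] := bagP i.
  exact: disj vx vy.
- move=> t; have [->|[i [x ->]]] := graftP t.
    by rewrite card_graft_root_arc.
  by rewrite card_graft_in_arc; have [_ _ _ degx] := bagP i; apply: degx.
Qed.

Lemma branchable1 k v : thickness [set v : D] <= k -> branchable k [set v].
Proof.
have E : [set v] =
    [set v] :|: \bigcup_(i : void) (fun i : void => set0 : {set D}) i.
  by rewrite big1 ?setU0.
rewrite [in X in X -> _]E => thk; rewrite E.
apply: branchable_graft => //; try by case.
by right; split; [apply: card_void | exists v].
Qed.

Lemma branchableU k (A B : {set D}) :
  branchable k A -> branchable k B -> [disjoint A & B] ->
  thickness (A :|: B) <= k -> branchable k (A :|: B).
Proof.
move=> brA brB disj.
have E : A :|: B = set0 :|: \bigcup_(b : bool) (if b then A else B).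
  by rewrite set0U big_bool.
rewrite E => thk.
apply: branchable_graft => //.
- by case.
- by move=> i; rewrite -setI_eq0 set0I.
- case=> -[] v //; first by move=> /(disjointFr disj)->.
  by move=> vB /(disjointFr disj); rewrite vB.
- by left; rewrite card_bool.
Qed.

(** Splitting off one index at a time gives a caterpillar of pieces, and each new cut is a union
    over a subset of [J]. *)
Lemma branchable_bigcup k (I : finType) (Bi : I -> {set D}) (J : {set I}) :
  J != set0 -> (forall i, i \in J -> branchable k (Bi i)) ->
  (forall i j v, i \in J -> j \in J -> v \in Bi i -> v \in Bi j -> i = j) ->
  (forall K : {set I}, K \subset J -> thickness (\bigcup_(i in K) Bi i) <= k) ->
  branchable k (\bigcup_(i in J) Bi i).
Proof.
have [n] := ubnP #|J|; elim: n J => // n IH J Jn /set0Pn[i iJ] brB disj thk.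
rewrite (big_setD1 i) //=.
have [->|JD0] := eqVneq (J :\ i) set0.
  by rewrite big_set0 setU0; apply: brB.
have sub : {subset J :\ i <= J} by move=> j /setD1P[].
apply: branchableU.
- exact: brB.
- apply: IH => //.
  + by move: Jn; rewrite (cardsD1 i) iJ.
  + by move=> j /sub; apply: brB.
  + by move=> j j' v /sub jJ /sub; apply: disj.
  + by move=> K /subset_trans KJ; apply/thk/KJ/subsetP.
- rewrite -setI_eq0; apply/set0Pn => -[v /setIP[vi /bigcupP[j jJ vj]]].
  have ij := disj _ _ _ iJ (sub j jJ) vi vj; subst j.
  by move: jJ; rewrite !inE eqxx.
- by rewrite -(big_setD1 i) //; apply: thk.
Qed.

Lemma branchable_dbw k : branchable k [set: D] -> dbw D <= k.
Proof.
case=> P [bag [bagT thk disj deg]].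
have edgeE (t : P) : #|pt_edge t| <= #|pt_arc t| + 1.
  have -> : #|pt_edge t| = #|[predU pt_arc t & [pred s | pt_arc s t]]|.
    by apply: eq_card => s.
  rewrite -(leq_add2r #|[predI pt_arc t & [pred s | pt_arc s t]]|) cardUI.
  rewrite -addnA leq_add2l; apply: leq_trans (_ : 1 <= _); last by lia.
  by apply/card_le1_eqP => s u; rewrite !inE /pt_arc /= => /eqP-> /eqP[].
have deg3 (t : P) : #|pt_edge t| <= 3.
  by apply: leq_trans (edgeE t) _; case: (deg t) => -[-> _].
(* A root with two children has degree 2, so it is not mistaken for a leaf; a lone root has degree 0
   and counts as one. *)
have leafE (t : P) : is_leaf (@pt_edge P) t = (#|pt_arc t| == 0).
  rewrite /is_leaf /=; have := edgeE t.
  have : #|pt_arc t| <= #|pt_edge t|.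
    apply: subset_leq_card; apply/subsetP => s ts.
    by rewrite /in_mem /= /pt_edge /= [pt_arc t s]ts.
  by case: (deg t) => -[-> _]; lia.
have leaf_bag (l : {t | is_leaf (@pt_edge P) t}) :
    exists v, bag (val l) = [set v].
  by have := valP l; rewrite leafE; case: (deg (val l)) => -[->].
pose delta l := sval (cid (leaf_bag l)).
have deltaP l : bag (val l) = [set delta l] := svalP (cid (leaf_bag l)).
have bag_leaf v t : v \in bag t -> exists2 l, delta l = v & val l = t.
  move=> vt; have tl : is_leaf (@pt_edge P) t.
    rewrite leafE; case: (deg t) => -[-> //] bt.
    by rewrite bt inE in vt.
  exists (exist _ t tl) => //.
  have /= bt := deltaP (exist _ t tl).
  by move: vt; rewrite bt inE => /eqP.
have delta_inj : injective delta.
  move=> l l' ll'; apply: val_inj; apply: (disj (delta l)).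
    by rewrite deltaP inE.
  by rewrite deltaP ll' inE.
have /choice[g gK] v : exists l, delta l = v.
  have : v \in [set: D] by [].
  by rewrite -bagT => /bigcupP[t _ /bag_leaf[l lv _]]; exists l.
have delta_bij : bijective delta.
  by exists g => // l; apply: delta_inj; rewrite gK.
pose B := DBranchDecomposition (pt_edge_tree P) deg3 delta_bij.
have sideE (x y : db_node B) : pt_arc y x ->
    @db_side D B x y = subtree_bag (@pt_arc P) bag x.
  move=> yx; apply/setP => v; have [l ->] := @db_deltaP D B v.
  rewrite mem_db_side /= pt_side //; apply/idP/bigcupP => [xl|[s xs]].
    by exists (val l) => //; rewrite deltaP inE.
  by move=> ls; rewrite -(disj (delta l) s (val l)) // deltaP inE.
apply: leq_trans (min_value_le _ _ B) _.
apply/bigmax_leqP => t1 _; apply/bigmax_leqP => t2 e12.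
case/orP: (e12) => [a12|a21]; last by rewrite sideE.
have e21 : @db_edge D B t2 t1 by rewrite /= /pt_edge /= orbC.
rewrite db_sideC // sideE //.
have /thickness_leP[S sepS Sk] := thk t2.
by apply/thickness_leP; exists S => //; apply: separatesC.
Qed.

End BranchwidthBound.

(** * Expanding the nodes of a directed tree decomposition *)

Section TreeDecomposition.
Variables (D : digraph) (W : dtree_decomposition D).
Local Notation bag := (@dt_bag D W).
Local Notation arcW := (@dt_arc D W).
Local Notation sub := (subtree_bag arcW bag).

Lemma dt_bag_disjoint v s t : v \in bag s -> v \in bag t -> s = t.
Proof.
move=> vs vt; apply: dt_bag_inj; apply/eqP; apply: contraT => st.
case/and3P: (dt_bag_partition W) => _ /trivIsetP triv _.
have disj := triv _ _ (imset_f bag (isT : s \in dt_node W))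
  (imset_f bag (isT : t \in dt_node W)) st.
by rewrite (disjointFr disj vs) in vt.
Qed.

Lemma dt_bag_neq0 t : bag t != set0.
Proof.
case/and3P: (dt_bag_partition W) => _ _; apply: contra => /eqP <-.
exact: imset_f.
Qed.

Lemma dt_Gamma_separates t (U : {set D}) :
  (forall u, u \in U -> u \in bag t \/
     exists2 c, arcW t c & u \in sub c /\ sub c \subset U) ->
  separates U (dt_Gamma t).
Proof.
move=> UP p /andP[cp _] [u up /UP[ut|[c tc [uc cU]]]] [v vp vU].
  by exists u => //; rewrite !inE ut.
(* Rotated to start at [u], the cycle is a closed walk from [sub c] that leaves it, because it
   leaves [U]. *)
have [i q qE] := rot_to up.
move: cp; rewrite -(rot_cycle i) qE /= => pth.
have [w wq wS] : exists2 w, w \in u :: rcons q u & w \in dt_guard t c.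
  apply: (dt_guardP tc pth) => //; first by rewrite last_rcons.
  exists v; last by apply: contra vU; apply: (subsetP cU).
  by rewrite -rcons_cons mem_rcons inE -qE mem_rot vp orbT.
exists w; last by rewrite inE; apply/orP; right; apply/bigcupP; exists c.
move: wq; rewrite -rcons_cons mem_rcons inE -qE mem_rot => /orP[/eqP->|] //.
Qed.

Lemma branchable_subtree k t :
  (forall s : dt_node W, #|dt_Gamma s| <= k) -> branchable k (sub t).
Proof.
move=> Gk; have [n] := ubnP #|sub t|; elim: n t => // n IH t tn.
(* The pieces at [t] are the single vertices of its bag and the subtrees at its children;
   [dt_Gamma t] separates every union of them. *)
pose Bi (x : D + dt_node W) := match x with inl v => [set v] | inr c => sub c end.
pose J := [set x | match x with inl v => v \in bag t | inr c => arcW t c end].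
have child_bag c v : arcW t c -> v \in sub c -> v \notin bag t.
  move=> tc /bigcupP[s cs vs]; apply: contraL cs => vt.
  by rewrite (dt_bag_disjoint vs vt) (arborescence_acyclic (dt_arborescence W)).
have subE : sub t = \bigcup_(x in J) Bi x.
  rewrite subtree_bag_rec; apply/setP => v; apply/setUP/bigcupP.
    case=> [vt|/bigcupP[c tc vc]]; first by exists (inl v); rewrite !inE.
    by exists (inr c); rewrite ?inE.
  case=> -[u|c]; rewrite !inE => xJ; first by move=> /eqP->; left.
  by move=> vc; right; apply/bigcupP; exists c.
have thk (K : {set D + dt_node W}) :
    K \subset J -> thickness (\bigcup_(x in K) Bi x) <= k.
  move=> KJ; apply/thickness_leP; exists (dt_Gamma t) => //.
  apply: dt_Gamma_separates => u /bigcupP[[v|c] xK]; have := subsetP KJ _ xK.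
    by rewrite !inE => vt /eqP->; left.
  rewrite !inE => tc uc; right; exists c => //; split=> //.
  exact: (bigcup_sup (inr c)).
have subn c : arcW t c -> #|sub c| < n.
  move=> tc; apply: leq_trans (_ : #|sub t| <= n); last by rewrite -ltnS.
  apply: proper_card; apply/properP; split.
    by rewrite [sub t]subtree_bag_rec subsetU // (bigcup_sup c) ?orbT.
  have /set0Pn[v vt] := dt_bag_neq0 t; exists v.
    by rewrite subtree_bag_rec inE vt.
  by apply: contraL vt; apply: child_bag.
rewrite subE; apply: branchable_bigcup => //.
- have /set0Pn[v vt] := dt_bag_neq0 t; apply/set0Pn; exists (inl v).
  by rewrite inE.
- move=> [v|c]; rewrite inE => xJ /=; last exact/IH/subn.
  apply: branchable1; have := thk [set inl v]; rewrite big_set1; apply.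
  by rewrite sub1set inE.
- move=> [u|c] [u'|c'] v; rewrite !inE => xJ yJ /=.
  + by move=> /eqP-> /eqP->.
  + by move=> /eqP-> /(child_bag _ _ yJ); rewrite xJ.
  + by move=> + /eqP vE; rewrite vE => /(child_bag _ _ xJ); rewrite yJ.
  move=> /bigcupP[s cs vs] /bigcupP[s' cs' vs'].
  rewrite -(dt_bag_disjoint vs vs') in cs'.
  by rewrite (arborescence_child_inj (dt_arborescence W) xJ yJ cs cs').
Qed.

Lemma dbw_le_Gamma k : (forall s : dt_node W, #|dt_Gamma s| <= k) -> dbw D <= k.
Proof.
move=> Gk; apply: branchable_dbw.
have [_ _ [r [rP _]]] := dt_arborescence W.
rewrite (_ : [set: D] = sub r); first exact: branchable_subtree.
apply/esym/eqP; rewrite eqEsubset subsetT /=.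
case/and3P: (dt_bag_partition W) => /eqP <- _ _.
apply/subsetP => v /bigcupP[_ /imsetP[t _ ->] vt].
by apply/bigcupP; exists t.
Qed.

End TreeDecomposition.

Lemma dbw_le_dtw (D : digraph) : dbw D - 1 <= dtw D.
Proof.
have [W WE] := min_value_attained (@dt_width D) (dtree_decomposition_exists D).
rewrite /dtw -WE /dt_width leq_sub2r //.
by apply: (@dbw_le_Gamma _ W) => s; apply: (leq_bigmax s).
Qed.

Theorem theorem3p5 (D : digraph) : dbw D - 1 <= dtw D <= 9 * dbw D + 1.
Proof. by rewrite dbw_le_dtw dtw_le_dbw. Qed.
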